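(* Let $D$ be a dataset over items $A=\{a_1,\dots,a_N\}$, $\mathcal{C}$ an itemset collection and $X$ an itemset. Then $$0\le \mathit{kl}(X)\le KL\big(p^*_{\mathcal{C}\cup\{X\}}\,\|\,p^*_{\mathcal{C}}\big).$$ Moreover, $\mathit{kl}(X)=0$ if and only if $KL\big(p^*_{\mathcal{C}\cup\{X\}}\,\|\,p^*_{\mathcal{C}}\big)=0$, i.e., when $\mathrm{fr}(X)=p^*_{\mathcal{C}}(X=1)$.
   Context: Transactions are $t\in\mathcal{T}=\{0,1\}^N$; $S_Y(t)=1$ iff $t_i=1$ for all $a_i\in Y$; a dataset $D$ is a finite nonempty multiset of transactions and $\mathrm{fr}(Y)$ the fraction of its transactions supporting $Y$. For a distribution $p$ on $\mathcal{T}$, $p(Y=1)=\sum_{t:S_Y(t)=1}p(A=t)$. For a collection $\mathcal{C}$, $p^*_{\mathcal{C}}$ is the unique entropy-maximizing distribution on $\mathcal{T}$ with $p(Y=1)=\mathrm{fr}(Y)$ for all $Y\in\mathcal{C}$. Logs base 2. $KL(p\|q)=\sum_t p(A=t)\log\frac{p(A=t)}{q(A=t)}$. For $x,y\in[0,1]$, $\mathit{kl}(x,y)=x\log\frac{x}{y}+(1-x)\log\frac{1-x}{1-y}$, and $\mathit{kl}(X)=\mathit{kl}\big(\mathrm{fr}(X),p^*_{\mathcal{C}}(X=1)\big)$. *)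

(* Defs.v *)
From HB Require Import structures.
From mathcomp Require Import all_boot all_order all_algebra.
From mathcomp Require Import finmap multiset.
From mathcomp Require Import all_classical all_reals all_analysis.
From mathcomp Require Import ring lra.

Set Implicit Arguments.
Unset Strict Implicit.
Unset Printing Implicit Defensive.
Import Order.TTheory GRing.Theory Num.Theory.
Import numFieldNormedType.Exports.
Local Open Scope classical_set_scope.
Local Open Scope ring_scope.

Definition transaction (N : nat) := {ffun 'I_N -> bool}.
Definition itemset (N : nat) := {set 'I_N}.
Notation dataset N := {mset transaction N}%mset.

Definition supports (N : nat) (Y : itemset N) (t : transaction N) : bool :=
  [forall i in Y, t i].

(* [count] and [size] take multiplicities into account: a multiset coerces to
   the sequence of its elements, each repeated according to its multiplicity. *)
Definition fr (R : realType) (N : nat) (D : dataset N) (Y : itemset N) : R :=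
  (count (supports Y) D)%:R / (size D)%:R.

Definition is_distribution (R : realType) (N : nat)
    (p : {ffun transaction N -> R}) : Prop :=
  (forall t, 0 <= p t) /\ \sum_t p t = 1.

Definition pr (R : realType) (N : nat) (p : {ffun transaction N -> R})
    (Y : itemset N) : R :=
  \sum_(t | supports Y t) p t.

Definition log2 (R : realType) (x : R) : R := ln x / ln 2.

(* The convention 0 log 0 = 0 holds since [ln 0 = 0] in the library. *)
Definition entropy (R : realType) (N : nat)
    (p : {ffun transaction N -> R}) : R :=
  - \sum_t p t * log2 (p t).

Definition feasible (R : realType) (N : nat) (D : dataset N)
    (C : {set itemset N}) (p : {ffun transaction N -> R}) : Prop :=
  is_distribution p /\ (forall Y, Y \in C -> pr p Y = fr R D Y).

Definition is_maxent (R : realType) (N : nat) (D : dataset N)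
    (C : {set itemset N}) (p : {ffun transaction N -> R}) : Prop :=
  feasible D C p /\ (forall q, feasible D C q -> entropy q <= entropy p).

(* [xget] chooses an element satisfying [is_maxent D C]; for [D] nonempty
   there is exactly one, by [is_maxent_exists] and [is_maxent_unique] below. *)
Definition pstar (R : realType) (N : nat) (D : dataset N)
    (C : {set itemset N}) : {ffun transaction N -> R} :=
  xget [ffun=> 0] (@is_maxent R N D C).

(* x log (x / y), with the usual conventions 0 log (0 / y) = 0 for all y and
   x log (x / 0) = +oo for x > 0. *)
Definition xlogxy (R : realType) (x y : R) : \bar R :=
  if x == 0 then 0%E
  else if y == 0 then +oo%E
  else (x * log2 (x / y))%:E.

Definition KL (R : realType) (N : nat)
    (p q : {ffun transaction N -> R}) : \bar R :=
  (\sum_t xlogxy (p t) (q t))%E.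

Definition kl (R : realType) (x y : R) : \bar R :=
  (xlogxy x y + xlogxy (1 - x) (1 - y))%E.

Definition kl_itemset (R : realType) (N : nat) (D : dataset N)
    (C : {set itemset N}) (X : itemset N) : \bar R :=
  kl (fr R D X) (pr (pstar R D C) X).

(* Strict midpoint convexity of x ln x on the nonnegative reals. *)
Lemma xlnx_midpoint (R : realType) (a b : R) : 0 <= a -> 0 <= b ->
  let m := (a + b) / 2 in
  m * ln m <= (a * ln a + b * ln b) / 2 ?= iff (a == b).
Proof.
have tangent (x m : R) : 0 <= x -> 0 < m ->
    x - m <= x * ln x - x * ln m ?= iff (x == m).
  move=> x0 m0; move: x0; rewrite le0r => /predU1P[->|x0].
    apply/leifP; rewrite [0 == m]eq_sym gt_eqF//; lra.
  apply/leifP; case: eqP => [->|/eqP xm]; first by rewrite !subrr.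
  have mx0 : 0 < m / x by rewrite divr_gt0.
  have lmx : ln (m / x) != 0.
    rewrite ln_eq0//; apply: contra xm => /eqP mx; apply/eqP.
    by rewrite -[RHS](divfK (lt0r_neq0 x0)) mx mul1r.
  have := expR_gt1Dx lmx; rewrite lnK ?posrE// ltr_pdivlMr//.
  by rewrite ln_div ?posrE// => h; lra.
move=> a0 b0 m.
have : 0 <= m by rewrite /m; lra.
rewrite le0r => /predU1P[m0|m0].
  have [-> ->] : a = 0 /\ b = 0 by move: m0; rewrite /m => m0; split; lra.
  by rewrite m0 eqxx; apply/leifP; rewrite !mul0r addr0 mul0r.
have [[A _] [B _]] := (tangent a m a0 m0, tangent b m b0 m0).
have mE : m * 2 = a + b by rewrite /m divfK.
apply/leifP; case: eqP => [ab|/eqP ab].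
  have -> : m = a by rewrite /m ab; lra.
  by rewrite -ab; lra.
have am : (a == m) = false.
  by apply: contraNF ab => /eqP am; apply/eqP; lra.
have /lt_leif := tangent a m a0 m0; rewrite am /= => A'.
have -> : m * ln m = (a * ln m + b * ln m) / 2.
  by rewrite -mulrDl -mE; lra.
lra.
Qed.

Lemma ln2_gt0 (R : realType) : 0 < ln 2 :> R.
Proof. by rewrite ln_gt0// ltr1n. Qed.

Lemma is_maxent_unique (R : realType) (N : nat) (D : dataset N)
    (C : {set itemset N}) (p q : {ffun transaction N -> R}) :
  is_maxent D C p -> is_maxent D C q -> p = q.
Proof.
move=> [fp pm] [fq qm].
have [[[p0 p1] pC] [[q0 q1] qC]] := (fp, fq).
pose m := [ffun t => (p t + q t) / 2] : {ffun transaction N -> R}.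
have fm : feasible D C m.
  split; [split=> [t|]|move=> Y YC].
  - by rewrite ffunE divr_ge0// addr_ge0.
  - under eq_bigr do rewrite ffunE.
    by rewrite -mulr_suml big_split/= p1 q1; lra.
  - rewrite /pr; under eq_bigr do rewrite ffunE.
    rewrite -mulr_suml big_split/= -/(pr p Y) -/(pr q Y) pC// qC//; lra.
have entE (r : {ffun transaction N -> R}) :
    entropy r = - (\sum_t r t * ln (r t)) / ln 2.
  by rewrite /entropy mulNr mulr_suml; under eq_bigr do rewrite mulrA.
have := leif_sum (fun t (_ : true) => xlnx_midpoint (p0 t) (q0 t)).
rewrite -mulr_suml big_split/=.
have := pm _ fm; have := pm _ fq; have := qm _ fp.
rewrite !entE !ler_pM2r ?invr_gt0 ?ln2_gt0// !lerN2.
have -> : \sum_t m t * ln (m t) =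
    \sum_t (p t + q t) / 2 * ln ((p t + q t) / 2).
  by apply: eq_bigr => t _; rewrite ffunE.
move=> h1 h2 h3 /leif_le h4.
have := leif_sum (fun t (_ : true) => xlnx_midpoint (p0 t) (q0 t)).
rewrite -mulr_suml big_split/= => /ge_leif h5.
apply/ffunP => t; apply/eqP.
have : [forall t, true ==> (p t == q t)] by rewrite -h5; lra.
by move=> /forallP/(_ t).
Qed.

Lemma continuous_xlnx (R : realType) : continuous (fun x : R => x * ln x).
Proof.
move=> x; have [x0|x0|->] := ltgtP x 0.
- have : (fun=> 0) @ x --> x * ln x.
    by rewrite ln0 ?ltW// mulr0; exact: cvg_cst.
  apply: cvg_trans; apply: near_eq_cvg.
  near=> y; rewrite ln0 ?mulr0//.
  by apply/ltW; near: y; exact: lt_nbhsl.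
- by apply: cvgM; [exact: cvg_id|exact: continuous_ln].
apply/cvgrPdist_lt => /= e e0; rewrite mul0r; near=> y.
rewrite sub0r normrN.
have [y0|y0] := leP y 0; first by rewrite ln0// mulr0 normr0.
have y1 : y < 1 by near: y; exact: lt_nbhsl.
have ye : y < (e / 2) ^+ 2.
  by near: y; apply: lt_nbhsl; rewrite exprn_gt0// divr_gt0.
pose s := Num.sqrt y.
have s0 : 0 < s by rewrite sqrtr_gt0.
have yE : y = s ^+ 2 by rewrite sqr_sqrtr// ltW.
have se : s < e / 2.
  by rewrite -(@ltr_pXn2r _ 2) ?nnegrE -?yE// ltW// divr_gt0.
have ls : ln s^-1 < s^-1 by rewrite ln_sublinear// invr_gt0.
have ly : ln y <= 0 by rewrite ln_le0// ltW.
rewrite ler0_norm ?mulr_ge0_le0 ?(ltW y0)//.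
rewrite yE lnXn// -mulr_natr.
move: ls; rewrite lnV ?posrE// => ls.
have : s ^+ 2 * (- ln s) < s ^+ 2 * s^-1 by rewrite ltr_pM2l ?exprn_gt0.
rewrite expr2 mulfK ?gt_eqF// => h; lra.
Unshelve. all: by end_near. Qed.

Lemma feasible_empirical (R : realType) (N : nat) (D : dataset N)
    (C : {set itemset N}) : D != mset0 ->
  feasible D C [ffun t => (count_mem t D)%:R / (size D)%:R : R].
Proof.
move=> D0.
have cnt (P : pred (transaction N)) (s : seq (transaction N)) :
    (\sum_(t | P t) count_mem t s)%N = count P s.
  apply: esym; rewrite -sum1_count (partition_big id P)//=; apply: eq_bigr => t Pt.
  rewrite -sum1_count; apply: eq_bigl => u.
  by rewrite -[RHS]/(u == t) andb_idl => // /eqP->.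
have sD : (size D)%:R != 0 :> R.
  rewrite pnatr_eq0 size_eq0; apply: contra D0 => /eqP D0.
  apply/eqP/msetP => u; rewrite mset0E; apply/eqP.
  by rewrite mset_eq0 -[_ \in _]/(u \in enum_mset D) D0.
split; [split=> [t|]|move=> Y _].
- by rewrite ffunE divr_ge0.
- under eq_bigr do rewrite ffunE.
  by rewrite -mulr_suml -natr_sum cnt count_predT divff.
- rewrite /pr; under eq_bigr do rewrite ffunE.
  by rewrite -mulr_suml -natr_sum cnt.
Qed.

Lemma is_maxent_exists (R : realType) (N : nat) (D : dataset N)
    (C : {set itemset N}) : D != mset0 ->
  exists p : {ffun transaction N -> R}, is_maxent D C p.
Proof.
move=> D0.
pose n := #|{: transaction N}|.
pose F (v : 'rV[R]_n) : {ffun transaction N -> R} :=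
  [ffun t => v 0 (enum_rank t)].
pose G (p : {ffun transaction N -> R}) : 'rV[R]_n :=
  \row_i p (enum_val i).
have GK p : F (G p) = p by apply/ffunP => t; rewrite ffunE mxE enum_rankK.
have cF t : continuous (fun v => F v t).
  rewrite (_ : (fun v => _) = (fun v : 'rV[R]_n => v 0 (enum_rank t))).
    exact: coord_continuous.
  by apply/funext => v; rewrite ffunE.
have cS (P : pred (transaction N)) : continuous (fun v => \sum_(t | P t) F v t).
  move=> v; rewrite (_ : (fun v => _) = (\sum_(t | P t) (fun v => F v t))).
    apply: (big_ind (fun f => {for v, continuous f})).
    - exact: cst_continuous.
    - by move=> f g cf cg; exact: continuousD.
    - by move=> t _; exact: cF.
  by apply/funext => w; rewrite fct_sumE.
pose A : set 'rV[R]_n := [set v | feasible D C (F v)]%classic.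
have [||| v vA vmax] := @EVT_max_rV R n (fun w => entropy (F w)) A.
- by exists (G [ffun t => (count_mem t D)%:R / (size D)%:R : R]);
    rewrite /A /= GK; exact: feasible_empirical.
- apply: bounded_closed_compact.
    exists 1; split; first by rewrite num_real.
    move=> M M1 v [[v0 v1] _] /=.
    apply: le_trans (ltW M1).
    rewrite [leLHS]mx_normrE; apply: bigmax_le => // -[i j] _ /=.
    rewrite [i]ord1.
    have := v0 (enum_val j); rewrite ffunE enum_valK => vj0.
    rewrite ger0_norm// -v1 (bigD1 (enum_val j))//= ffunE enum_valK.
    by rewrite lerDl sumr_ge0.
  rewrite (_ : A = [set v | forall t, [set v | 0 <= F v t] v] `&`
     ([set v | \sum_t F v t = 1] `&`
     [set v | forall Y, Y \in C -> pr (F v) Y = fr R D Y]))%classic; last first.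
    apply/seteqP; split => v; rewrite /A /feasible /is_distribution /=.
      by move=> [[]].
    by move=> [? []].
  have clE (f : 'rV[R]_n -> R) y : continuous f ->
      closed [set v | f v = y]%classic.
    move=> cf; apply: (@preimage_closed _ _ f [set y]).
      by move=> ? _; exact: cf.
    exact: closed_eq.
  apply: closedI; last (apply: closedI; first exact/clE/cS).
    rewrite (_ : mkset _ = \bigcap_(t in setT) [set v | 0 <= F v t])%classic.
      apply: closed_bigI => t _.
      apply: (@preimage_closed _ _ (fun v => F v t) [set x | 0 <= x]%classic).
        by move=> ? _; exact: cF.
      exact: closed_ge.
    by apply/seteqP; split => [v h t _|v h t]; [exact: (h t)|exact: (h t I)].
  rewrite (_ : mkset _ = \bigcap_(Y in [set` C])
      [set v | pr (F v) Y = fr R D Y])%classic.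
    by apply: closed_bigI => Y _; exact/clE/cS.
  by apply/seteqP; split.
- have cxlnx : continuous (fun w => \sum_t F w t * ln (F w t)).
    move=> w; rewrite (_ : (fun w => _) = \sum_t (fun w => F w t * ln (F w t))).
      apply: (big_ind (fun f => {for w, continuous f})).
      - exact: cst_continuous.
      - by move=> f g cf cg; exact: continuousD.
      - move=> t _; apply: (@continuous_comp _ _ _ (fun w => F w t)
          (fun x => x * ln x)); [exact: cF|exact: continuous_xlnx].
    by apply/funext => u; rewrite fct_sumE.
  apply: continuous_subspaceT.
  rewrite (_ : (fun w => entropy (F w)) =
      (fun w => - (\sum_t F w t * ln (F w t)) * (ln 2)^-1)).
    by move=> w; exact: (cvgM (cvgN (cxlnx w)) (cvg_cst _)).
  apply/funext => w; rewrite /= /entropy mulNr mulr_suml.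
  by under eq_bigr do rewrite mulrA.
exists (F v); split; first by move: vA; rewrite inE.
move=> q fq; have := vmax (G q); rewrite /= GK; apply.
by rewrite inE /A /= GK.
Qed.

Lemma pstarP (R : realType) (N : nat) (D : dataset N)
    (C : {set itemset N}) : D != mset0 -> is_maxent D C (pstar R D C).
Proof.
by move=> D0; have [p pm] := is_maxent_exists R C D0;
  exact: (xgetPex _ (ex_intro _ p pm)).
Qed.

(* Main.v *)
Require Import Defs.
From HB Require Import structures.
From mathcomp Require Import all_boot all_order all_algebra.
From mathcomp Require Import finmap multiset.
From mathcomp Require Import all_classical all_reals all_analysis.
From mathcomp Require Import ring lra.

(* Let [p] and [q] be the maximum entropy distributions for [X |: C] and [C].
   Coarsening transactions to the single bit "supports X" does not increase
   relative entropy (log-sum inequality on each of the two classes), and turns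
   [KL p q] into [kl (fr X) (pr q X)]. If the latter vanishes then [q] already
   satisfies the constraint on [X]; being optimal for the weaker constraints
   [C], it is optimal for [X |: C], so [p = q] by uniqueness. *)

Set Implicit Arguments.
Unset Strict Implicit.
Unset Printing Implicit Defensive.
Import Order.TTheory GRing.Theory Num.Theory.
Local Open Scope ring_scope.

(* The tangent line to [x log x], in homogeneous form: [c = 1] gives Gibbs'
   inequality, and [c] the ratio of the totals gives the log-sum inequality. *)
Lemma xlogxy_tangent (R : realType) (a b c : R) : 0 <= a -> 0 <= b -> 0 < c ->
  ((a * log2 c + (a - c * b) / ln 2)%:E <= xlogxy a b ?= iff (a == c * b))%O.
Proof.
move=> a0 b0 c0; have l2 := ln2_gt0 R.
rewrite /xlogxy; case: eqVneq => [->|an0].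
  rewrite mul0r add0r sub0r; split.
    by rewrite lee_fin mulNr oppr_le0 divr_ge0 ?mulr_ge0// ltW.
  by rewrite eqe mulf_eq0 oppr_eq0 invr_eq0 (gt_eqF l2) orbF eq_sym.
case: eqVneq => [->|bn0].
  by rewrite mulr0 (negbTE an0); split; rewrite ?leey.
have a_gt0 : 0 < a by rewrite lt0r an0.
have b_gt0 : 0 < b by rewrite lt0r bn0.
(* The gap between the two sides is a positive multiple of [expR l - (1 + l)], so both the bound and
   its equality case come from [1 + l < expR l] for [l != 0]. *)
pose l := ln (c * b / a).
have cba : expR l = c * b / a by rewrite lnK// posrE divr_gt0 ?mulr_gt0.
have gap : a * log2 (a / b) - (a * log2 c + (a - c * b) / ln 2) =
    a * (expR l - (1 + l)) / ln 2.
  rewrite cba /l /log2 !ln_div ?posrE ?mulr_gt0// lnM ?posrE//.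
  by field; rewrite !gt_eqF.
have -> : (a == c * b) = (l == 0).
  rewrite ln_eq0 ?divr_gt0 ?mulr_gt0// -[RHS](inj_eq (mulIf an0)) divfK// mul1r.
  exact: eq_sym.
apply/leifP; case: eqVneq => [l0|ln0].
  by rewrite eqe eq_sym -subr_eq0 gap l0 expR0 addr0 subrr mulr0 mul0r.
by rewrite lte_fin -subr_gt0 gap divr_gt0// mulr_gt0// subr_gt0 expR_gt1Dx.
Qed.

(** Rules out [+oo - oo], so that a single infinite term makes a whole sum [+oo]. *)
Lemma xlogxy_neqNy (R : realType) (x y : R) : xlogxy x y != -oo%E.
Proof. by rewrite /xlogxy; case: ifP => // _; case: ifP. Qed.

Lemma xlogxx (R : realType) (x : R) : xlogxy x x = 0%E.
Proof.
by rewrite /xlogxy; case: eqVneq => // x0; rewrite divff// /log2 ln1 mul0r mulr0.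
Qed.

Lemma log_sum (R : realType) (I : finType) (P : pred I) (a b : I -> R) :
  (forall i, 0 <= a i) -> (forall i, 0 <= b i) ->
  (xlogxy (\sum_(i | P i) a i) (\sum_(i | P i) b i) <=
    \sum_(i | P i) xlogxy (a i) (b i))%E.
Proof.
move=> a0 b0; set A := \sum_(i | P i) a i; set B := \sum_(i | P i) b i.
have A0 : 0 <= A by exact: sumr_ge0.
have B0 : 0 <= B by exact: sumr_ge0.
have [AE|An0] := eqVneq A 0.
  rewrite {1}/xlogxy AE eqxx big1// => i Pi.
  have /eqP := AE; rewrite psumr_eq0// => /allP/(_ i).
  by rewrite mem_index_enum Pi => /(_ isT)/eqP ai; rewrite /xlogxy ai eqxx.
have A_gt0 : 0 < A by rewrite lt0r An0.
have [BE|Bn0] := eqVneq B 0.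
  (* Here [A] is positive and [B] is zero: some nonzero [a i] faces [b i = 0], and this term alone
     makes the right side [+oo]. *)
  have [i Pi ai] : exists2 i, P i & a i != 0.
    apply/exists_inP; apply: contraNT An0 => /exists_inPn h.
    by apply/eqP/big1 => i Pi; have := h i Pi; rewrite negbK => /eqP.
  have bi : b i = 0.
    have /eqP := BE; rewrite psumr_eq0// => /allP/(_ i).
    by rewrite mem_index_enum Pi => /(_ isT)/eqP.
  suff -> : (\sum_(i | P i) xlogxy (a i) (b i) = +oo)%E by rewrite leey.
  apply/eqP; rewrite esum_eqy => [|j _]; last exact: xlogxy_neqNy.
  by apply/exists_inP; exists i; rewrite // /xlogxy (negbTE ai) bi eqxx.
have B_gt0 : 0 < B by rewrite lt0r Bn0.
have c0 : 0 < A / B by rewrite divr_gt0.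
(* With the common ratio [A / B], the linear corrections sum to [A - A / B * B = 0], so the tangent
   bounds add up exactly to [xlogxy A B]. *)
have -> : xlogxy A B = (\sum_(i | P i)
    (a i * log2 (A / B) + (a i - A / B * b i) / ln 2)%:E)%E.
  rewrite sumEFin big_split/= -!mulr_suml sumrB -mulr_sumr -/A -/B divfK//.
  by rewrite subrr mul0r addr0 /xlogxy (negbTE An0) (negbTE Bn0).
by apply: lee_sum => i _; have [] := xlogxy_tangent (a0 i) (b0 i) c0.
Qed.

Lemma kl_ge0 (R : realType) (x y : R) : 0 <= x <= 1 -> 0 <= y <= 1 ->
  (0%E <= kl x y ?= iff (x == y))%O.
Proof.
move=> /andP[x0 x1] /andP[y0 y1].
have gibbs (u v : R) : 0 <= u -> 0 <= v ->
    (((u - v) / ln 2)%:E <= xlogxy u v ?= iff (u == v))%O.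
  move=> u0 v0; have := xlogxy_tangent u0 v0 ltr01.
  by rewrite /log2 ln1 mul0r mulr0 add0r mul1r.
apply/leifP; case: eqVneq => [->|xy]; first by rewrite /kl !xlogxx adde0.
(* The Gibbs bounds for the two outcomes are opposite numbers and cancel; both are strict when
   [x != y]. *)
have -> : 0%E = (((x - y) / ln 2)%:E + ((1 - x - (1 - y)) / ln 2)%:E)%E.
  by rewrite -EFinD -mulrDl; congr EFin; ring.
apply: lteD.
  by have := gibbs _ _ x0 y0; rewrite (negbTE xy) => /leifP.
have := gibbs (1 - x) (1 - y); rewrite !subr_ge0 => /(_ x1 y1).
have -> : (1 - x == 1 - y) = false.
  by apply: contraNF xy => /eqP h; apply/eqP; lra.
by move/leifP.
Qed.

Lemma prC (R : realType) (N : nat) (p : {ffun transaction N -> R})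
    (Y : itemset N) : is_distribution p ->
  \sum_(t | ~~ supports Y t) p t = 1 - pr p Y.
Proof.
by case=> _ <-; rewrite [X in _ = X - _](bigID (supports Y))/= addrAC subrr add0r.
Qed.

Lemma pr_itv (R : realType) (N : nat) (p : {ffun transaction N -> R})
    (Y : itemset N) : is_distribution p -> 0 <= pr p Y <= 1.
Proof.
move=> dp; have [p0 _] := dp.
by rewrite sumr_ge0//= -subr_ge0 -prC// sumr_ge0.
Qed.

Lemma kl_pr_le_KL (R : realType) (N : nat) (p q : {ffun transaction N -> R})
    (Y : itemset N) : is_distribution p -> is_distribution q ->
  (kl (pr p Y) (pr q Y) <= KL p q)%E.
Proof.
move=> dp dq; have [[p0 _] [q0 _]] := (dp, dq).
rewrite /KL (bigID (supports Y))/= /kl -!prC//.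
by apply: leeD; exact: log_sum.
Qed.

Lemma KLxx (R : realType) (N : nat) (p : {ffun transaction N -> R}) :
  KL p p = 0%E.
Proof. by rewrite /KL big1// => t _; exact: xlogxx. Qed.

Lemma pstar_setU1 (R : realType) (N : nat) (D : dataset N)
    (C : {set itemset N}) (X : itemset N) : D != mset0 ->
  pr (pstar R D C) X = fr R D X -> pstar R D (X |: C)%SET = pstar R D C.
Proof.
move=> D0 qX; have [[dq qC] qmax] := pstarP R C D0.
apply: is_maxent_unique (pstarP R _ D0) _; split.
  by split=> // Y; rewrite in_setU1 => /predU1P[->|/qC].
(* Dropping the constraint on [X] leaves the competitor [r] feasible for [C]. *)
move=> r [dr rC]; apply: qmax; split=> // Y YC.
by apply: rC; rewrite in_setU1 YC orbT.
Qed.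

Theorem theorem6p2 (R : realType) (N : nat) (D : dataset N)
    (C : {set itemset N}) (X : itemset N) (hD : D != mset0) :
  [/\ (0 <= kl_itemset R D C X)%E,
      (kl_itemset R D C X <= KL (pstar R D (X |: C)%SET) (pstar R D C))%E,
      kl_itemset R D C X = 0%E <->
        KL (pstar R D (X |: C)%SET) (pstar R D C) = 0%E &
      kl_itemset R D C X = 0%E <-> fr R D X = pr (pstar R D C) X].
Proof.
have [[dp pC] _] := pstarP R (X |: C)%SET hD.
have [[dq _] _] := pstarP R C hD.
have pX : pr (pstar R D (X |: C)%SET) X = fr R D X by rewrite pC ?setU11.
have le_kl : (kl_itemset R D C X <= KL (pstar R D (X |: C)%SET) (pstar R D C))%E.
  by rewrite /kl_itemset -pX; exact: kl_pr_le_KL.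
have [kl0 klE] : (0%E <= kl_itemset R D C X ?= iff
    (fr R D X == pr (pstar R D C) X))%O.
  (* The frequency lies in the unit interval because, by [pX], it is a probability. *)
  by apply: kl_ge0; rewrite -?pX pr_itv.
have kl0E : kl_itemset R D C X = 0%E <-> fr R D X = pr (pstar R D C) X.
  split=> [h|h]; first by apply/eqP; rewrite -klE h.
  by apply/esym/eqP; rewrite klE h.
split=> //; split=> [/kl0E h|h]; first by rewrite pstar_setU1 ?KLxx.
(* A vanishing [KL] squeezes [kl_itemset] between 0 and 0. *)
by apply/eqP; rewrite eq_le kl0 -h le_kl.
Qed.
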